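(* Let $m,c_1,c_2\ge 1$ be integers, let $\bar{Q},\bar{K}\in\mathbb{R}^{m\times c_1}$ and $\tilde{Q},\tilde{K}\in\mathbb{R}^{m\times c_2}$ be real matrices, and let $U_m\in\mathbb{R}^{m\times m}$ be the all-ones matrix. Write $\bar{q}_{i_1}$ and $\bar{k}_{i_2}$ for the $i_1$-th row of $\bar{Q}$ and the $i_2$-th row of $\bar{K}$, with $j$-th entries $\bar{q}_{i_1 j}$ and $\bar{k}_{i_2 j}$. Let $$\mathfrak{M}=\max_{\substack{1\le i_1,i_2\le m\\ 1\le j\le c_1}}\exp\left(\bar{q}_{i_1}\bar{k}_{i_2}^{\top}+0.5-(\bar{q}_{i_1j}+\bar{k}_{i_2j})\right)>0,\qquad \mathscr{M}=\min_{\substack{1\le i_1,i_2\le m\\ 1\le j\le c_1}}\exp\left(\bar{q}_{i_1}\bar{k}_{i_2}^{\top}+0.5-(\bar{q}_{i_1j}+\bar{k}_{i_2j})\right)>0.$$ Let $\xi\in\{2,F\}$. (i) If $\left|\frac{c_1}{\mathscr{M}\exp(-0.5)}-1\right|\ge\left|\frac{c_1}{\mathfrak{M}\exp(-0.5)}-1\right|$, then $$\left\|\exp(\bar{Q})\exp(\bar{K})^{\top}-\exp(\bar{Q}\bar{K}^{\top})\odot\exp(\tilde{Q}\tilde{K}^{\top})\right\|_\xi\le\frac{c_1}{\mathscr{M}\exp(-0.5)}\left\|\exp(\bar{Q}\bar{K}^{\top})\right\|_\xi\left\|U_m-\exp(\tilde{Q}\tilde{K}^{\top})\right\|_\xi+\left|\frac{c_1}{\mathscr{M}\exp(-0.5)}-1\right|\left\|\exp(\bar{Q}\bar{K}^{\top})\right\|_\xi\left\|\exp(\tilde{Q}\tilde{K}^{\top})\right\|_\xi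 .$$ (ii) If $\left|\frac{c_1}{\mathscr{M}\exp(-0.5)}-1\right|<\left|\frac{c_1}{\mathfrak{M}\exp(-0.5)}-1\right|$, then $$\left\|\exp(\bar{Q})\exp(\bar{K})^{\top}-\exp(\bar{Q}\bar{K}^{\top})\odot\exp(\tilde{Q}\tilde{K}^{\top})\right\|_\xi\le\frac{c_1}{\mathscr{M}\exp(-0.5)}\left\|\exp(\bar{Q}\bar{K}^{\top})\right\|_\xi\left\|U_m-\exp(\tilde{Q}\tilde{K}^{\top})\right\|_\xi+\left|\frac{c_1}{\mathfrak{M}\exp(-0.5)}-1\right|\left\|\exp(\bar{Q}\bar{K}^{\top})\right\|_\xi\left\|\exp(\tilde{Q}\tilde{K}^{\top})\right\|_\xi .$$
   Context: The function $\exp$ applied to a matrix acts entrywise (it is not the matrix exponential). $\odot$ is the Hadamard (entrywise) product. $\|\cdot\|_2$ is the spectral norm and $\|\cdot\|_F$ the Frobenius norm; $\|\cdot\|_\xi$ denotes either one, the same choice throughout the inequality. All vectors are row vectors, so $\bar{q}_{i_1}\bar{k}_{i_2}^{\top}$ is the inner product. *)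

(* Defs.v *)
From HB Require Import structures.
From mathcomp Require Import all_boot all_order all_algebra.
From mathcomp Require Import all_classical all_reals all_analysis.

Set Implicit Arguments.
Unset Strict Implicit.
Unset Printing Implicit Defensive.

Import Order.TTheory GRing.Theory Num.Theory.
Local Open Scope classical_set_scope.
Local Open Scope ring_scope.

(* Entrywise exponential, not the matrix exponential. *)
Definition expE (R : realType) (m n : nat) (A : 'M[R]_(m, n)) : 'M[R]_(m, n) :=
  map_mx expR A.

Definition hadamard (R : realType) (m n : nat) (A B : 'M[R]_(m, n)) :
  'M[R]_(m, n) := map2_mx *%R A B.

Definition frobenius (R : realType) (m n : nat) (A : 'M[R]_(m, n)) : R :=
  Num.sqrt (\sum_i \sum_j A i j ^+ 2).

(* On a column vector, [frobenius] is the Euclidean norm. *)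
Definition spectral (R : realType) (m n : nat) (A : 'M[R]_(m, n)) : R :=
  sup [set frobenius (A *m x) | x in [set x : 'cV[R]_n | frobenius x <= 1]].

Inductive norm_index := Spectral | Frobenius.

Definition xi_norm (xi : norm_index) (R : realType) (m n : nat)
    (A : 'M[R]_(m, n)) : R :=
  match xi with Spectral => spectral A | Frobenius => frobenius A end.

(* The element [t0] is the starting value of the iteration, so that these are
   the true maximum and minimum of [f], independently of [t0]. *)
Definition fmax (R : realType) (T : finType) (t0 : T) (f : T -> R) : R :=
  \big[Num.max/f t0]_(t : T) f t.

Definition fmin (R : realType) (T : finType) (t0 : T) (f : T -> R) : R :=
  \big[Num.min/f t0]_(t : T) f t.

Definition exp_gap (R : realType) (m c : nat) (Q K : 'M[R]_(m, c))
    (t : 'I_m * 'I_m * 'I_c) : R :=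
  let: (i1, i2, j) := t in
  expR ((row i1 Q *m (row i2 K)^T) 0 0 + 2^-1 - (Q i1 j + K i2 j)).

Definition gap_max (R : realType) (m c : nat) (hm : (0 < m)%N) (hc : (0 < c)%N)
    (Q K : 'M[R]_(m, c)) : R :=
  fmax (Ordinal hm, Ordinal hm, Ordinal hc) (exp_gap Q K).

Definition gap_min (R : realType) (m c : nat) (hm : (0 < m)%N) (hc : (0 < c)%N)
    (Q K : 'M[R]_(m, c)) : R :=
  fmin (Ordinal hm, Ordinal hm, Ordinal hc) (exp_gap Q K).

(* Main.v *)
Require Import Defs.
From mathcomp Require Import all_boot all_order all_algebra.
From mathcomp Require Import all_classical all_reals all_analysis.
From mathcomp Require Import ring lra.
Import Order.TTheory GRing.Theory Num.Theory.
Local Open Scope ring_scope.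

(** Write [P = exp(Q) exp(K)^T].  Each summand of [P i j] is
    [E i j * e^(1/2)] divided by the corresponding gap, so [P i j] lies between
    [a_max * E i j] and [a_min * E i j].  Split
    [P - E o T = P o (U - T) + (P - E) o T], where [o] is the Hadamard product:
    both norms are submultiplicative for [o] and monotone under entrywise
    domination by a nonnegative matrix, and [P] is dominated by [a_min E] and
    [P - E] by [max(|a_min - 1|, |a_max - 1|) E]. *)

Lemma sum_cauchy_schwarz (R : realFieldType) (I : finType) (a b : I -> R) :
  (\sum_i a i * b i) ^+ 2 <= (\sum_i a i ^+ 2) * (\sum_i b i ^+ 2).
Proof.
(* Lagrange's identity *)
have : 0 <= \sum_i \sum_j (a i * b j - a j * b i) ^+ 2.
  by apply: sumr_ge0 => i _; apply: sumr_ge0 => j _; exact: sqr_ge0.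
suff -> : \sum_i \sum_j (a i * b j - a j * b i) ^+ 2 =
    2 * ((\sum_i a i ^+ 2) * (\sum_i b i ^+ 2) - (\sum_i a i * b i) ^+ 2).
  by rewrite pmulr_rge0 // subr_ge0.
(* Each term is a function of [i] times a function of [j], so the double sum factors into products
   of single sums. *)
have sqrE i j : (a i * b j - a j * b i) ^+ 2 = a i ^+ 2 * b j ^+ 2
    + b i ^+ 2 * a j ^+ 2 + (-2 * (a i * b i)) * (a j * b j) by ring.
under eq_bigr => i _ do under eq_bigr => j _ do rewrite sqrE.
under eq_bigr => i _ do rewrite !big_split /= -!mulr_sumr.
rewrite !big_split /= -!mulr_suml -mulr_sumr.
ring.
Qed.

(** * Frobenius norm: triangle inequality, domination, products *)

Section Frobenius.
Context {R : realType}.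

Lemma frobenius_ge0 m n (A : 'M[R]_(m, n)) : 0 <= frobenius A.
Proof. exact: sqrtr_ge0. Qed.

Lemma sqr_frobenius m n (A : 'M[R]_(m, n)) :
  frobenius A ^+ 2 = \sum_i \sum_j A i j ^+ 2.
Proof.
rewrite sqr_sqrtr//.
by apply: sumr_ge0 => i _; apply: sumr_ge0 => j _; exact: sqr_ge0.
Qed.

Lemma sqr_frobenius_col m n (A : 'M[R]_(m, n)) :
  frobenius A ^+ 2 = \sum_j frobenius (col j A) ^+ 2.
Proof.
rewrite sqr_frobenius exchange_big /=; apply: eq_bigr => j _.
by rewrite sqr_frobenius; apply: eq_bigr => i _; rewrite big_ord1 mxE.
Qed.

Lemma frobenius_le_sqr m n (A : 'M[R]_(m, n)) (c : R) :
  0 <= c -> \sum_i \sum_j A i j ^+ 2 <= c ^+ 2 -> frobenius A <= c.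
Proof. by move=> c0; rewrite -sqr_frobenius ler_sqr// nnegrE frobenius_ge0. Qed.

Lemma frobenius_tr m n (A : 'M[R]_(m, n)) : frobenius A^T = frobenius A.
Proof.
rewrite /frobenius exchange_big /=; congr Num.sqrt.
by apply: eq_bigr => i _; apply: eq_bigr => j _; rewrite mxE.
Qed.

Lemma frobenius0 m n : frobenius (0 : 'M[R]_(m, n)) = 0.
Proof.
rewrite /frobenius big1 ?sqrtr0// => i _.
by rewrite big1// => j _; rewrite mxE expr0n.
Qed.

Lemma frobenius_eq0 m n (A : 'M[R]_(m, n)) : frobenius A = 0 -> A = 0.
Proof.
move=> A0; apply/matrixP => i j; rewrite mxE; apply/eqP.
rewrite -sqrf_eq0 eq_le sqr_ge0 andbT.
(* Turns [A i j ^+ 2 <= 0] into the comparison of one term with the whole sum of squares. *)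
have -> : 0 = frobenius A ^+ 2 by rewrite A0 expr0n.
rewrite sqr_frobenius (bigD1 i)//= (bigD1 j)//= -addrA lerDl addr_ge0//.
  by apply: sumr_ge0 => k _; exact: sqr_ge0.
by apply: sumr_ge0 => k _; apply: sumr_ge0 => l _; exact: sqr_ge0.
Qed.

Lemma ler_frobenius m n (A B : 'M[R]_(m, n)) :
  (forall i j, `|A i j| <= B i j) -> frobenius A <= frobenius B.
Proof.
move=> AB; apply: ler_wsqrtr; apply: ler_sum => i _; apply: ler_sum => j _.
rewrite -(real_normK (num_real (A i j))) ler_sqr ?nnegrE ?AB//.
exact: le_trans (AB i j).
Qed.

Lemma frobeniusZ m n (c : R) (A : 'M[R]_(m, n)) :
  frobenius (c *: A) = `|c| * frobenius A.
Proof.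
rewrite -sqrtr_sqr /frobenius -sqrtrM ?sqr_ge0// mulr_sumr.
congr Num.sqrt; apply: eq_bigr => i _; rewrite mulr_sumr.
by apply: eq_bigr => j _; rewrite mxE exprMn.
Qed.

Lemma ler_frobeniusD m n (A B : 'M[R]_(m, n)) :
  frobenius (A + B) <= frobenius A + frobenius B.
Proof.
apply: frobenius_le_sqr; first by rewrite addr_ge0 ?frobenius_ge0.
(* The cross term of the expanded square: Cauchy-Schwarz over pairs of indices. *)
have AB : \sum_i \sum_j A i j * B i j <= frobenius A * frobenius B.
  apply: ler_normlW; rewrite -ler_sqr ?nnegrE ?mulr_ge0 ?frobenius_ge0//.
  rewrite real_normK ?num_real// exprMn !sqr_frobenius !pair_bigA /=.
  exact: (@sum_cauchy_schwarz _ _ (fun p => A p.1 p.2) (fun p => B p.1 p.2)).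
rewrite sqrrD !sqr_frobenius.
under eq_bigr => i _ do under eq_bigr => j _ do rewrite mxE sqrrD.
under eq_bigr => i _ do rewrite !big_split /=.
rewrite !big_split /= lerD2r lerD2l.
by rewrite mulr2n lerD.
Qed.

(** Cauchy-Schwarz on each row of [A]. This is what bounds the set whose supremum is
    [spectral A]. *)
Lemma frobenius_mulmx_col m n (A : 'M[R]_(m, n)) (x : 'cV[R]_n) :
  frobenius (A *m x) <= frobenius A * frobenius x.
Proof.
apply: frobenius_le_sqr; first by rewrite mulr_ge0 ?frobenius_ge0.
rewrite exprMn !sqr_frobenius mulr_suml; apply: ler_sum => i _.
rewrite big_ord1 mxE.
under [X in _ * X]eq_bigr => j _ do rewrite big_ord1.
exact: sum_cauchy_schwarz.
Qed.

(** Termwise, since each [B i j ^+ 2] is at most the full sum of squares of [B]. *)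
Lemma frobenius_hadamard m n (A B : 'M[R]_(m, n)) :
  frobenius (hadamard A B) <= frobenius A * frobenius B.
Proof.
apply: frobenius_le_sqr; first by rewrite mulr_ge0 ?frobenius_ge0.
rewrite exprMn !sqr_frobenius mulr_suml; apply: ler_sum => i _.
rewrite mulr_suml; apply: ler_sum => j _.
rewrite mxE exprMn ler_wpM2l ?sqr_ge0//.
rewrite (bigD1 i)//= (bigD1 j)//= -addrA lerDl addr_ge0//.
  by apply: sumr_ge0 => k _; exact: sqr_ge0.
by apply: sumr_ge0 => k _; apply: sumr_ge0 => l _; exact: sqr_ge0.
Qed.

End Frobenius.

(** * Spectral norm as an operator norm, with the analogous properties *)

Section Spectral.
Context {R : realType}.

Lemma frobenius_le_spectral m n (A : 'M[R]_(m, n)) (x : 'cV[R]_n) :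
  frobenius x <= 1 -> frobenius (A *m x) <= spectral A.
Proof.
move=> x1; apply: ub_le_sup; last by exists x.
exists (frobenius A) => _ [y /= y1 <-].
rewrite (le_trans (frobenius_mulmx_col _ _ A y))//.
by rewrite ler_piMr ?frobenius_ge0.
Qed.

Lemma spectral_ge0 m n (A : 'M[R]_(m, n)) : 0 <= spectral A.
Proof.
rewrite -(@frobenius0 R m 1) -(mulmx0 _ A).
by apply: frobenius_le_spectral; rewrite frobenius0.
Qed.

Lemma frobenius_mulmx_spectral_col m n (A : 'M[R]_(m, n)) (x : 'cV[R]_n) :
  frobenius (A *m x) <= spectral A * frobenius x.
Proof.
have [/frobenius_eq0 ->|x0] := eqVneq (frobenius x) 0.
  by rewrite mulmx0 !frobenius0 mulr0.
have xgt0 : 0 < frobenius x by rewrite lt_def x0 frobenius_ge0.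
(* By homogeneity, [x] may be rescaled to a unit vector. *)
rewrite -ler_pdivrMr// mulrC -[(frobenius x)^-1]gtr0_norm ?invr_gt0//.
rewrite -frobeniusZ scalemxAr; apply: frobenius_le_spectral.
by rewrite frobeniusZ gtr0_norm ?invr_gt0// mulVf.
Qed.

(** Column by column: the squared Frobenius norm adds up over columns, and column [j] of [A *m B] is
    [A] applied to column [j] of [B]. *)
Lemma frobenius_mulmx_spectral m n p (A : 'M[R]_(m, n)) (B : 'M[R]_(n, p)) :
  frobenius (A *m B) <= spectral A * frobenius B.
Proof.
rewrite -ler_sqr ?nnegrE ?mulr_ge0 ?frobenius_ge0 ?spectral_ge0//.
rewrite exprMn sqr_frobenius_col (sqr_frobenius_col _ _ B) mulr_sumr.
apply: ler_sum => j _.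
rewrite colE -mulmxA -colE -exprMn.
rewrite ler_sqr ?nnegrE ?mulr_ge0 ?frobenius_ge0 ?spectral_ge0//.
exact: frobenius_mulmx_spectral_col.
Qed.

Lemma spectral_le m n (A : 'M[R]_(m, n)) (c : R) : 0 <= c ->
  (forall x : 'cV[R]_n, frobenius (A *m x) <= c * frobenius x) ->
  spectral A <= c.
Proof.
move=> c0 Ac; apply: ge_sup.
  by exists (frobenius (A *m (0 : 'cV_n))), 0 => //=; rewrite frobenius0.
by move=> _ [x /= x1 <-]; rewrite (le_trans (Ac x))// ler_piMr.
Qed.

Lemma ler_spectralD m n (A B : 'M[R]_(m, n)) :
  spectral (A + B) <= spectral A + spectral B.
Proof.
apply: spectral_le => [|x]; first by rewrite addr_ge0 ?spectral_ge0.
rewrite mulmxDl mulrDl (le_trans (ler_frobeniusD _ _ _ _))//.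
by rewrite lerD ?frobenius_mulmx_spectral_col.
Qed.

Lemma spectralZ_le m n (c : R) (A : 'M[R]_(m, n)) :
  spectral (c *: A) <= `|c| * spectral A.
Proof.
apply: spectral_le => [|x]; first by rewrite mulr_ge0 ?spectral_ge0.
by rewrite -scalemxAl frobeniusZ -mulrA ler_wpM2l ?frobenius_mulmx_spectral_col.
Qed.

(** Taking absolute values in [x] keeps its norm, and the entries of [A *m x] are then dominated by
    those of [B *m y]. *)
Lemma ler_spectral m n (A B : 'M[R]_(m, n)) :
  (forall i j, `|A i j| <= B i j) -> spectral A <= spectral B.
Proof.
move=> AB; apply: spectral_le => [|x]; first exact: spectral_ge0.
pose y := map_mx Num.norm x.
have -> : frobenius x = frobenius y.
  rewrite /frobenius; congr Num.sqrt; apply: eq_bigr => i _.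
  by apply: eq_bigr => j _; rewrite mxE real_normK ?num_real.
apply: le_trans (frobenius_mulmx_spectral_col _ _ B y).
apply: ler_frobenius => i j; rewrite !mxE (le_trans (ler_norm_sum _ _ _))//.
by apply: ler_sum => k _; rewrite normrM mxE ler_wpM2r.
Qed.

(* [(A o B) x] is the diagonal of [A diag(x) B^T]. *)
Lemma spectral_hadamard m n (A B : 'M[R]_(m, n)) :
  spectral (hadamard A B) <= spectral A * spectral B.
Proof.
apply: spectral_le => [|x]; first by rewrite mulr_ge0 ?spectral_ge0.
pose D : 'M[R]_n := diag_mx x^T.
have -> : frobenius x = frobenius D.
  rewrite /frobenius; congr Num.sqrt; apply: eq_bigr => i _.
  rewrite big_ord1 (bigD1 i)//= big1 ?addr0 ?mxE ?eqxx ?mulr1n// => j ji.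
  by rewrite !mxE eq_sym (negPf ji) mulr0n expr0n.
have diagE i : (hadamard A B *m x) i 0 = (A *m (D *m B^T)) i i.
  rewrite !mxE; apply: eq_bigr => j _.
  by rewrite mul_diag_mx !mxE; ring.
(* Discarding off-diagonal entries can only decrease the Frobenius norm. *)
apply: (@le_trans _ _ (frobenius (A *m (D *m B^T)))).
  apply: ler_wsqrtr; apply: ler_sum => i _.
  rewrite big_ord1 diagE (bigD1 i)//= lerDl.
  by apply: sumr_ge0 => j _; exact: sqr_ge0.
rewrite (le_trans (frobenius_mulmx_spectral _ _ _ _ _))// -mulrA.
(* Transposition moves [B] to the left of the diagonal matrix, where the same one-sided bound
   applies. *)
rewrite ler_wpM2l ?spectral_ge0// -frobenius_tr trmx_mul trmxK.
by rewrite (le_trans (frobenius_mulmx_spectral _ _ _ _ _))// frobenius_tr.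
Qed.

End Spectral.

(** * Uniform treatment of the two norms *)

Section XiNorm.
Context {R : realType} (xi : norm_index) (m n : nat).
Implicit Types A B : 'M[R]_(m, n).

Lemma xi_norm_ge0 A : 0 <= xi_norm xi A.
Proof. by case: xi; [exact: spectral_ge0|exact: frobenius_ge0]. Qed.

Lemma ler_xi_normD A B : xi_norm xi (A + B) <= xi_norm xi A + xi_norm xi B.
Proof. by case: xi; [exact: ler_spectralD|exact: ler_frobeniusD]. Qed.

Lemma xi_norm_hadamard A B :
  xi_norm xi (hadamard A B) <= xi_norm xi A * xi_norm xi B.
Proof. by case: xi; [exact: spectral_hadamard|exact: frobenius_hadamard]. Qed.

Lemma ler_xi_norm A B :
  (forall i j, `|A i j| <= B i j) -> xi_norm xi A <= xi_norm xi B.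
Proof. by case: xi; [exact: ler_spectral|exact: ler_frobenius]. Qed.

Lemma xi_normZ_le (c : R) A : xi_norm xi (c *: A) <= `|c| * xi_norm xi A.
Proof. by case: xi; [exact: spectralZ_le|rewrite /= frobeniusZ]. Qed.

Lemma xi_norm_le_scale (c : R) A B : 0 <= c ->
  (forall i j, `|A i j| <= c * B i j) -> xi_norm xi A <= c * xi_norm xi B.
Proof.
move=> c0 AB; rewrite -[X in X * _]ger0_norm//.
by rewrite (le_trans _ (xi_normZ_le c B))// ler_xi_norm// => i j; rewrite mxE.
Qed.

End XiNorm.

(** The theorem freed of exponentials. A single [d] bounding both deviations from 1 serves both of
    its cases. *)
Lemma xi_norm_sub_hadamard_le (R : realType) (xi : norm_index) (m n : nat)
    (P E T : 'M[R]_(m, n)) (lo hi d : R) :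
  0 <= lo -> `|lo - 1| <= d -> `|hi - 1| <= d ->
  (forall i j, 0 <= E i j) ->
  (forall i j, lo * E i j <= P i j <= hi * E i j) -> 0 <= hi ->
  xi_norm xi (P - hadamard E T) <=
    hi * xi_norm xi E * xi_norm xi (const_mx 1 - T)
    + d * xi_norm xi E * xi_norm xi T.
Proof.
move=> lo0 lod hid E0 PE hi0.
have -> : P - hadamard E T =
    hadamard P (const_mx 1 - T) + hadamard (P - E) T.
  by apply/matrixP => i j; rewrite !mxE; ring.
rewrite (le_trans (ler_xi_normD _ _ _ _ _))// lerD//;
  rewrite (le_trans (xi_norm_hadamard _ _ _ _ _))//;
  rewrite ler_wpM2r ?xi_norm_ge0//; apply: xi_norm_le_scale => //.
- move=> i j; have /andP[loP hiP] := PE i j.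
  by rewrite ger0_norm// (le_trans _ loP)// mulr_ge0.
- exact: le_trans lod.
move=> i j; have /andP[loP hiP] := PE i j.
(* [P - E] lies between [(lo - 1) * E] and [(hi - 1) * E] entrywise; [- d <= lo - 1] and
   [hi - 1 <= d] are multiplied by [E i j >= 0]. *)
move: lod hid; rewrite !ler_norml => /andP[lod _] /andP[_ hid].
by have Eij := E0 i j; rewrite !mxE; apply/andP; split; nra.
Qed.

(** * Entrywise bounds on the product of exponentials *)

Section Gap.
Context {R : realType} (m c : nat) (hm : (0 < m)%N) (hc : (0 < c)%N).
Context (Q K : 'M[R]_(m, c)).

Lemma exp_gap_gt0 t : 0 < exp_gap Q K t.
Proof. by case: t => [[i1 i2] j]; exact: expR_gt0. Qed.

Lemma exp_gap_le_max t : exp_gap Q K t <= gap_max hm hc Q K.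
Proof. exact: le_bigmax. Qed.

Lemma gap_min_le t : gap_min hm hc Q K <= exp_gap Q K t.
Proof. exact: bigmin_le. Qed.

Lemma gap_max_gt0 : 0 < gap_max hm hc Q K.
Proof.
exact: lt_le_trans (exp_gap_gt0 (Ordinal hm, Ordinal hm, Ordinal hc))
  (exp_gap_le_max _).
Qed.

Lemma gap_min_gt0 : 0 < gap_min hm hc Q K.
Proof. by apply/bigmin_gtP; split => [|t _]; exact: exp_gap_gt0. Qed.

(** The halves cancel: the denominator is the exponential of the inner product minus
    [Q i1 j + K i2 j]. *)
Lemma expRD_exp_gap i1 i2 j :
  expR (Q i1 j) * expR (K i2 j) =
  expE (Q *m K^T) i1 i2 / (exp_gap Q K (i1, i2, j) * expR (- 2^-1)).
Proof.
have -> : expE (Q *m K^T) i1 i2 = expR ((row i1 Q *m (row i2 K)^T) 0 0).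
  by rewrite !mxE; congr expR; apply: eq_bigr => k _; rewrite !mxE.
by rewrite /= -!expRD -expRN -expRD; congr expR; ring.
Qed.

(** Replacing all [c] gaps in the sum by one extreme value makes the terms equal, whence the factor
    [c]. Gaps are divisors, so the largest one gives the lower bound. *)
Lemma expE_mul_gap_bounds i1 i2 :
  c%:R / (gap_max hm hc Q K * expR (- 2^-1)) * expE (Q *m K^T) i1 i2
  <= (expE Q *m (expE K)^T) i1 i2
  <= c%:R / (gap_min hm hc Q K * expR (- 2^-1)) * expE (Q *m K^T) i1 i2.
Proof.
have E0 : 0 <= expE (Q *m K^T) i1 i2 by rewrite mxE expR_ge0.
have e0 : 0 < expR (- 2^-1) :> R by exact: expR_gt0.
have sumE (x : R) : c%:R / x * expE (Q *m K^T) i1 i2 =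
    \sum_(j < c) expE (Q *m K^T) i1 i2 / x.
  by rewrite sumr_const card_ord -[RHS]mulr_natl; ring.
rewrite !sumE [(expE Q *m _) _ _]mxE.
apply/andP; split; apply: ler_sum => j _;
  rewrite [_^T _ _]mxE [expE Q _ _]mxE [expE K _ _]mxE expRD_exp_gap;
  rewrite ler_wpM2l// lef_pV2 ?posrE ?mulr_gt0 ?exp_gap_gt0//;
  rewrite ?ler_pM2r//.
- exact: exp_gap_le_max.
- exact: gap_max_gt0.
- exact: gap_min_le.
- exact: gap_min_gt0.
Qed.

End Gap.

Theorem theoremA1 (R : realType) (m c1 c2 : nat)
    (hm : (0 < m)%N) (hc1 : (0 < c1)%N) (hc2 : (0 < c2)%N)
    (Qb Kb : 'M[R]_(m, c1)) (Qt Kt : 'M[R]_(m, c2)) (xi : norm_index) :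
  let U : 'M[R]_m := const_mx 1 in
  let Mmax := gap_max hm hc1 Qb Kb in
  let Mmin := gap_min hm hc1 Qb Kb in
  let a_min := c1%:R / (Mmin * expR (- 2^-1)) in
  let a_max := c1%:R / (Mmax * expR (- 2^-1)) in
  let E := expE (Qb *m Kb^T) in
  let Et := expE (Qt *m Kt^T) in
  let lhs := xi_norm xi (expE Qb *m (expE Kb)^T - hadamard E Et) in
  [/\ 0 < Mmax,
      0 < Mmin,
      `|a_max - 1| <= `|a_min - 1| ->
        lhs <= a_min * xi_norm xi E * xi_norm xi (U - Et)
               + `|a_min - 1| * xi_norm xi E * xi_norm xi Et
    & `|a_min - 1| < `|a_max - 1| ->
        lhs <= a_min * xi_norm xi E * xi_norm xi (U - Et)
               + `|a_max - 1| * xi_norm xi E * xi_norm xi Et].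
Proof.
move=> U Mmax Mmin a_min a_max E Et lhs.
have Mmax0 : 0 < Mmax by exact: gap_max_gt0.
have Mmin0 : 0 < Mmin by exact: gap_min_gt0.
have amin0 : 0 <= a_min by rewrite divr_ge0// mulr_ge0 ?expR_ge0// ltW.
have amax0 : 0 <= a_max by rewrite divr_ge0// mulr_ge0 ?expR_ge0// ltW.
have E0 i j : 0 <= E i j by rewrite mxE expR_ge0.
have PE i j : a_max * E i j <= (expE Qb *m (expE Kb)^T) i j <= a_min * E i j.
  exact: expE_mul_gap_bounds.
(* Here [lo] is [a_max] and [hi] is [a_min]; [d] is the larger of the two deviations, [a_min]'s in
   the first case and [a_max]'s in the second. *)
split=> // [amaxmin|/ltW aminmax];
  exact: (@xi_norm_sub_hadamard_le _ _ _ _ _ _ _ a_max).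
Qed.
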